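(* Let $G=(V,E)$ be a finite graph on $n$ nodes and let $\lambda_1=0\le\lambda_2\le\lambda_3\le\dots\le\lambda_n$ be the eigenvalues (with multiplicity) of its Laplacian $L$. Let $1\le k\le n-1$, let $y\in\mathbb{R}^V$ be an eigenvector of $L$ belonging to $\lambda_k$, and set $w_i=y_i^2$ for $i\in V$ and $c=(\lambda_{k+1}-\lambda_k)/2$. Suppose that the weighted graph $(G_y^+,w)$ is $(a,c)$-partitionable and the weighted graph $(G_y^-,w)$ is $(b,c)$-partitionable. Then $a+b\le k$.
   Context: For a vector $x\in\mathbb{R}^V$, $\mathrm{supp}_+(x)=\{i\in V: x_i>0\}$ and $\mathrm{supp}_-(x)=\{i\in V: x_i<0\}$; $G_x^+$ and $G_x^-$ denote the subgraphs of $G$ induced by $\mathrm{supp}_+(x)$ and $\mathrm{supp}_-(x)$ respectively. For a graph $H=(U,F)$ with nonnegative node weights $(w_i: i\in U)$, write $w(S)=\sum_{i\in S}w_i$, and for $S\subseteq U$ with $0<w(S)<w(U)$ define $\Phi_{H,w}(S)=\dfrac{\sum_{i\in S,\, j\in U\setminus S,\, ij\in F}\sqrt{w_iw_j}}{\min(w(S),w(U\setminus S))}$ (the sum is over edges of $H$ joining $S$ to $U\setminus S$). The weighted graph $(H,w)$ is called $(m,c)$-partitionable if $U$ has a partition $U=S_1\cup\dots\cup S_m$ into sets with $w(S_i)>0$ such that $\Phi_{H,w}(S_i)<c$ for all $1\le i\le m$. *)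

(* Defs.v *)
From mathcomp Require Import all_boot all_order all_algebra.
From mathcomp Require Import reals.

Set Implicit Arguments.
Unset Strict Implicit.
Unset Printing Implicit Defensive.

Import Order.TTheory GRing.Theory Num.Theory.
Local Open Scope ring_scope.

Definition degree (V : finType) (e : rel V) (i : V) : nat := #|[set j | e i j]|.

(* Rows and columns follow the enumeration of V. *)
Definition laplacian (R : realType) (V : finType) (e : rel V) : 'M[R]_#|V| :=
  \matrix_(i, j) (if i == j then (degree e (enum_val i))%:R
                  else - (e (enum_val i) (enum_val j))%:R).

Definition vec (R : realType) (V : finType) (x : V -> R) : 'cV[R]_#|V| :=
  \col_i x (enum_val i).

(* Increasing and repeated by algebraic multiplicity; as in every 0-based
   sequence, the k-th eigenvalue is lam`_k.-1. *)
Definition ordered_spectrum (R : realType) (n : nat) (A : 'M[R]_n)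
    (lam : n.-tuple R) : Prop :=
  sorted <=%R lam /\ char_poly A = \prod_(a <- lam) ('X - a%:P).

Definition supp_pos (R : realType) (V : finType) (x : V -> R) : {set V} :=
  [set i | 0 < x i].

Definition supp_neg (R : realType) (V : finType) (x : V -> R) : {set V} :=
  [set i | x i < 0].

(* A graph H = (U, F) is given by its node set U, a subset of the ambient
   finite type, and its adjacency relation F. *)
Definition induced (V : finType) (e : rel V) (U : {set V}) : rel V :=
  [rel i j | [&& i \in U, j \in U & e i j]].

Definition weight (R : realType) (V : finType) (w : V -> R) (S : {set V}) : R :=
  \sum_(i in S) w i.

(* For S = U the quotient is 0 / 0 = 0, so that a one-part partition, whose cut
   is empty, has conductance 0. *)
Definition Phi (R : realType) (V : finType) (U : {set V}) (F : rel V)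
    (w : V -> R) (S : {set V}) : R :=
  (\sum_(i in S) \sum_(j in U :\: S | F i j) Num.sqrt (w i * w j))
    / Num.min (weight w S) (weight w (U :\: S)).

(* The parts are nonempty, hence pairwise distinct, so a partition into m parts
   is a set of m blocks; m = 0 occurs exactly for U = set0. *)
Definition partitionable (R : realType) (V : finType) (U : {set V}) (F : rel V)
    (w : V -> R) (m : nat) (c : R) : Prop :=
  exists P : {set {set V}},
    [/\ partition P U, #|P| = m
      & forall S, S \in P -> 0 < weight w S /\ Phi U F w S < c].

(* Main.v *)
Require Import Defs.
From mathcomp Require Import all_boot all_order all_algebra.
From mathcomp Require Import reals complex spectral ring.

Set Implicit Arguments.
Unset Strict Implicit.
Unset Printing Implicit Defensive.

Import Order.TTheory GRing.Theory Num.Theory.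
Local Open Scope ring_scope.
Local Open Scope sesquilinear_scope.

(* Write z_i = g_i y_i with g constant on each of the a + b blocks.  Because y
   is an eigenvector,
     z^T L z - lambda_k z^T z = sum_(edges ij) y_i y_j (g_i - g_j)^2.
   Edges inside a block contribute 0, those between supp_+ and supp_- at most 0,
   and the others at most 2 y_i y_j (g_i^2 + g_j^2), so that the sum is at most
   2 sum_S g_S^2 cut(S).  Since Phi(S) < c gives cut(S) < c w(S), it follows
   that z^T L z < (lambda_k + 2c) z^T z = lambda_(k+1) z^T z for z <> 0.  These
   z form a space of dimension a + b, which is therefore at most the number of
   eigenvalues smaller than lambda_(k+1). *)

(** * Counting eigenvalues of Hermitian and real symmetric matrices *)

Lemma char_poly_conj (R : comUnitRingType) (n : nat) (P A : 'M[R]_n) :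
  P \in unitmx -> char_poly (invmx P *m A *m P) = char_poly A.
Proof.
move=> uP; rewrite /char_poly.
have -> : char_poly_mx (invmx P *m A *m P) =
    map_mx polyC (invmx P) *m char_poly_mx A *m map_mx polyC P.
  rewrite /char_poly_mx mulmxBr mulmxBl !map_mxM; congr (_ - _).
  by rewrite mul_mx_scalar -scalemxAl -map_mxM mulVmx // map_mx1 scalemx1.
rewrite !det_mulmx mulrAC -det_mulmx -map_mxM mulVmx // map_mx1 det1.
by rewrite mul1r.
Qed.

Lemma spectral_diag_perm (C : numClosedFieldType) (n : nat) (A : 'M[C]_n)
    (s : seq C) :
  A \is hermsymmx -> char_poly A = \prod_(a <- s) ('X - a%:P) ->
  perm_eq s [seq spectral_diag A 0 i | i <- enum 'I_n].
Proof.
move=> hA hs; apply: prod_XsubC_eq; rewrite -hs.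
have /orthomx_spectralP {1}-> := hermitian_normalmx hA.
rewrite char_poly_conj ?spectral_unit // char_poly_trig ?diag_mx_is_trig //.
rewrite big_map big_enum; apply: eq_bigr => i _.
by rewrite mxE eqxx.
Qed.

(** One half of Courant-Fischer: a space on which [mu%:M - A] is positive definite meets the span of
    the eigenvectors with eigenvalue at least [mu] only in 0. Strict positivity also forces
    [v *m W != 0], so the rows of [W] are independent. *)
Lemma hermitian_inertia (C : numClosedFieldType) (n m : nat) (A : 'M[C]_n)
    (W : 'M[C]_(m, n)) (s : seq C) (mu : C) :
  A \is hermsymmx -> char_poly A = \prod_(a <- s) ('X - a%:P) ->
  mu \is Num.real ->
  (forall v : 'rV[C]_m, v != 0 ->
     0 < (v *m W *m (mu%:M - A) *m (v *m W)^t*) 0 0) ->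
  (m <= count (< mu) s)%N.
Proof.
move=> hA hs rmu hW.
rewrite (permP (spectral_diag_perm hA hs)) count_map.
set P := spectralmx A; set d := spectral_diag A.
have dr i : d 0 i \is Num.real.
  by have /mxOverP := hermitian_spectral_diag_real hA; apply.
set T := [set i | d 0 i < mu].
have -> : count (preim (d 0) (< mu)) (enum 'I_n) = #|T|.
  by rewrite -size_filter cardE /enum_mem -filter_predI; congr size;
     apply: eq_filter => i; rewrite /= !inE andbT.
rewrite leqNgt; apply/negP => lt_m.
have uP : P \is unitarymx := spectral_unitarymx A.
(* If m > #|T|, some nonzero v in the coordinates of W is mapped into the span
   of the eigenvectors with eigenvalue at least mu. *)
pose f (i : 'I_#|T|) := enum_val i.
pose M : 'M_(m, #|T|) := colsub f (W *m P^t*).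
have : kermx M != 0.
  rewrite -mxrank_eq0 mxrank_ker subn_eq0 -ltnNge.
  exact: leq_ltn_trans (rank_leq_col _) lt_m.
case/rowV0Pn => v /sub_kermxP vM v0.
set u := v *m W *m P^t*.
have u0 i : d 0 i < mu -> u 0 i = 0.
  move=> di; have iT : i \in T by rewrite inE.
  have /rowP/(_ (enum_rank_in iT i)) := vM.
  by rewrite mulmx_colsub mulmxA !mxE /f enum_rankK_in // => {2}<-; rewrite mxE.
have := hW v v0; rewrite le_gtF //.
have -> : mu%:M - A = P^t* *m diag_mx (const_mx mu - d) *m P.
  have /orthomx_spectralP -> := hermitian_normalmx hA.
  rewrite -/P -/d -invmx_unitary // linearB /= diag_const_mx mulmxBr mulmxBl.
  by rewrite mul_mx_scalar -scalemxAl mulVmx ?spectral_unit // scalemx1.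
have -> : v *m W *m (P^t* *m diag_mx (const_mx mu - d) *m P) *m (v *m W)^t* =
    u *m diag_mx (const_mx mu - d) *m u^t*.
  by rewrite /u [in RHS]trmx_mul map_mxM trmxCK !mulmxA.
move: u u0 => u u0; rewrite mxE sumr_le0 // => i _; rewrite mul_mx_diag !mxE.
case: (real_ltP (dr i) rmu) => [/u0 ->|le_mu]; first by rewrite !mul0r.
by rewrite mulrAC -normCK mulr_ge0_le0 ?exprn_ge0 // subr_le0.
Qed.

(** For [v = u1 + i u2] the symmetry of [N] cancels the cross terms, leaving the real form at [u1]
    plus that at [u2]; one of these vectors is nonzero. *)
Lemma complex_posdef (R : rcfType) (m : nat) (N : 'M[R]_m) :
  N^T = N -> (forall v : 'rV[R]_m, v != 0 -> 0 < (v *m N *m v^T) 0 0) ->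
  forall v : 'rV[R[i]]_m, v != 0 ->
  0 < (v *m map_mx (real_complex R) N *m v^t*) 0 0.
Proof.
move=> symN posN v v0; set toC := real_complex R.
pose u1 := map_mx (@complex.Re R) v; pose u2 := map_mx (@complex.Im R) v.
have vE : v = map_mx toC u1 + 'i *: map_mx toC u2.
  by apply/rowP=> j; rewrite !mxE [LHS]complexE.
have vtE : v^t* = map_mx toC u1^T - 'i *: map_mx toC u2^T.
  by apply/colP=> j; rewrite !mxE; case: (v 0 j) => x z; simpc.
have cross : u2 *m N *m u1^T = u1 *m N *m u2^T.
  have tr11 (M : 'M[R]_1) : M^T = M by apply/matrixP=> i j; rewrite !ord1 mxE.
  by rewrite -[LHS]tr11 !trmx_mul trmxK symN mulmxA.
have -> : v *m map_mx toC N *m v^t* =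
    map_mx toC (u1 *m N *m u1^T + u2 *m N *m u2^T).
  rewrite vtE {1}vE !mulmxDl !mulmxBr -!scalemxAl -!scalemxAr -!map_mxM cross.
  rewrite scalerA -expr2 sqrCi scaleN1r opprK map_mxD.
  by rewrite addrA addrNK.
rewrite mxE ltcR mxE.
have ge0 (u : 'rV_m) : 0 <= (u *m N *m u^T) 0 0.
  by have [->|/posN/ltW//] := eqVneq u 0; rewrite !mul0mx mxE.
have [u10|/posN u1_gt0] := eqVneq u1 0; last by rewrite ltr_wpDr.
rewrite ltr_wpDl // posN //; apply: contra v0 => /eqP u20.
by rewrite vE u10 u20 !map_mx0 scaler0 addr0.
Qed.

(** Passes to [R[i]] to use the Hermitian case; positivity there comes from [complex_posdef] for the
    symmetric matrix [W *m (mu%:M - A) *m W^T]. *)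
Lemma symmetric_inertia (R : rcfType) (n m : nat) (A : 'M[R]_n)
    (W : 'M[R]_(m, n)) (s : seq R) (mu : R) :
  A^T = A -> char_poly A = \prod_(a <- s) ('X - a%:P) ->
  (forall v : 'rV[R]_m, v != 0 ->
     0 < (v *m W *m (mu%:M - A) *m (v *m W)^T) 0 0) ->
  (m <= count (< mu) s)%N.
Proof.
move=> symA charA posW; set toC := real_complex R.
have -> : count (< mu) s = count (< toC mu) (map toC s).
  by rewrite count_map; apply: eq_count => x /=; rewrite ltcR.
have conjM p q (B : 'M[R]_(p, q)) : (map_mx toC B)^t* = map_mx toC B^T.
  by apply/matrixP=> i j; rewrite !mxE; simpc.
apply: (hermitian_inertia (A := map_mx toC A) (W := map_mx toC W)).
- by apply/is_hermitianmxP; rewrite expr0 scale1r conjM symA.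
- rewrite -map_char_poly charA rmorph_prod big_map.
  by apply: eq_bigr => a _; rewrite /= map_polyXsubC.
- by rewrite complex_real.
- move=> v v0.
  have : 0 < (v *m map_mx toC (W *m (mu%:M - A) *m W^T) *m v^t*) 0 0.
    apply: complex_posdef v0.
      by rewrite !trmx_mul trmxK linearB /= symA tr_scalar_mx mulmxA.
    by move=> u /posW; rewrite trmx_mul !mulmxA.
  by rewrite !map_mxM map_mxB map_scalar_mx trmx_mul map_mxM conjM !mulmxA.
Qed.

Lemma count_lt_nth_le (R : realDomainType) (s : seq R) (k : nat) :
  sorted <=%R s -> (count (< nth 0%R s k) s <= k)%N.
Proof.
move=> s_sorted; have [le_s|lt_k] := leqP (size s) k.
  exact: leq_trans (count_size _ _) le_s.
rewrite -[X in count _ X](cat_take_drop k) count_cat.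
have -> : count (< nth 0%R s k) (drop k s) = 0%N.
  apply/eqP; rewrite -leqn0 leqNgt -has_count; apply/hasPn => x.
  case/(nthP 0) => i; rewrite size_drop ltn_subRL => lt_i <-.
  rewrite nth_drop -leNgt.
  by apply: (sorted_leq_nth le_trans le_refl) => //; rewrite ?inE ?leq_addr.
rewrite addn0; apply: leq_trans (count_size _ _) _.
by rewrite size_take lt_k.
Qed.

(** * The Laplacian energy of blockwise multiples of an eigenvector, and cuts *)

Lemma laplacian_mul (R : realType) (V : finType) (e : rel V) (x : V -> R) :
  irreflexive e ->
  laplacian R e *m vec x = vec (fun i => \sum_(j | e i j) (x i - x j)).
Proof.
move=> e_irr; apply/colP=> r; rewrite !mxE; set i := enum_val r.
rewrite big_split /= sumr_const.
have -> : #|[pred j | e i j]| = degree e i.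
  by rewrite /degree; apply: eq_card => j; rewrite !inE.
rewrite (bigD1 r) //= !mxE eqxx mulr_natl; congr (_ + _).
rewrite [RHS]big_mkcond.
rewrite (big_enum_val (A := V) (fun j => if e i j then - x j else 0)) /=.
rewrite [RHS](bigD1 r) //= -/i e_irr add0r.
apply: eq_bigr => j jr; rewrite !mxE eq_sym (negPf jr) -/i.
by case: (e i _); rewrite ?mulN1r // oppr0 mul0r.
Qed.

Lemma vec_dotE (R : realType) (V : finType) (x z : V -> R) :
  ((vec x)^T *m vec z) 0 0 = \sum_i x i * z i.
Proof.
rewrite mxE (big_enum_val (A := V) (fun i => x i * z i)) /=.
by apply: eq_bigr => i _; rewrite !mxE.
Qed.

(** The last sum runs over ordered pairs and so counts every edge twice, whence the [*+ 2] on the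
    other terms. *)
Lemma energy_eigenfunction_mul (R : realType) (V : finType) (e : rel V)
    (y : V -> R) (l : R) (f : V -> R) :
  symmetric e -> (forall i, \sum_(j | e i j) (y i - y j) = l * y i) ->
  (\sum_i f i * y i * \sum_(j | e i j) (f i * y i - f j * y j)) *+ 2 =
  (l * \sum_i (f i * y i) ^+ 2) *+ 2 +
  \sum_i \sum_(j | e i j) y i * y j * (f i - f j) ^+ 2.
Proof.
move=> e_sym y_eigen.
(* What is left of f_i y_i (f_i y_i - f_j y_j) after removing f_i^2 y_i (y_i - y_j), to which the
   eigenvector equation applies. *)
pose T := \sum_i \sum_(j | e i j) y i * y j * (f i ^+ 2 - f i * f j).
have -> : \sum_i f i * y i * \sum_(j | e i j) (f i * y i - f j * y j) =
    l * \sum_i (f i * y i) ^+ 2 + T.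
  rewrite mulr_sumr -big_split; apply: eq_bigr => i _ /=.
  have -> : l * (f i * y i) ^+ 2 = f i ^+ 2 * y i * (l * y i) by ring.
  rewrite -y_eigen !mulr_sumr -big_split; apply: eq_bigr => j _ /=; ring.
(* Adding to [T] its copy with i and j exchanged completes the square (f_i - f_j)^2. *)
rewrite mulrnDl; congr (_ + _); rewrite mulr2n {2}/T.
rewrite (exchange_big_dep xpredT) //= -big_split; apply: eq_bigr => i _ /=.
rewrite [X in _ + X](eq_bigl (e i)) => [|j]; last exact: e_sym.
by rewrite -big_split; apply: eq_bigr => j _ /=; ring.
Qed.

(** [p] assigns a block to each vertex where [y] is nonzero; elsewhere [z] vanishes. The cuts keep
    only edges whose ends have the same sign, since the other edges add at most 0 to the energy. *)
Lemma energy_lt (R : realType) (V : finType) (e : rel V)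
    (y : V -> R) (l : R) (T : finType) (B : {set T}) (p : V -> T)
    (g : T -> R) (c : R) (z : V -> R) :
  symmetric e -> (forall i, \sum_(j | e i j) (y i - y j) = l * y i) ->
  (forall i, y i != 0 -> p i \in B) ->
  (forall S, S \in B ->
     \sum_(i | p i == S)
       \sum_(j | [&& e i j, 0 < y i * y j & p i != p j]) y i * y j
     < c * \sum_(i | p i == S) y i ^+ 2) ->
  (exists2 S, S \in B & g S != 0) ->
  z =1 (fun i => g (p i) * y i) ->
  \sum_i z i * \sum_(j | e i j) (z i - z j) < (l + c *+ 2) * \sum_i z i ^+ 2.
Proof.
move=> e_sym y_eigen pB cutB [S0 S0B gS0] zE.
pose Q i j := [&& e i j, 0 < y i * y j & p i != p j].
have Qsym i j : Q i j = Q j i by rewrite /Q e_sym mulrC (eq_sym (p i)).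
have Q0 i : y i = 0 -> \sum_(j | Q i j) y i * y j = 0.
  by move=> yi; apply: big1 => j _; rewrite yi mul0r.
have cut_lt :
    \sum_i g (p i) ^+ 2 * \sum_(j | Q i j) y i * y j < c * \sum_i z i ^+ 2.
  (* A vertex with [p i] outside [B] has [y i = 0], so [h] vanishes there and the sum regroups by
     blocks. *)
  have by_block (h : V -> R) : (forall i, y i = 0 -> h i = 0) ->
      \sum_i g (p i) ^+ 2 * h i =
      \sum_(S in B) g S ^+ 2 * \sum_(i | p i == S) h i.
    move=> h0; rewrite (bigID (fun i => p i \in B)) /= addrC big1 => [|i piB].
      rewrite add0r (partition_big p (mem B)) //=; apply: eq_bigr => S SB.
      rewrite mulr_sumr; apply: eq_big => [i|i /andP[_ /eqP ->] //].
      by case: eqP => [->|]; rewrite ?SB ?andbF.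
    by rewrite h0 ?mulr0 //; apply/eqP; apply: contraNT piB => /pB.
  rewrite by_block //.
  have -> : \sum_i z i ^+ 2 = \sum_i g (p i) ^+ 2 * y i ^+ 2.
    by apply: eq_bigr => i _; rewrite zE exprMn.
  rewrite by_block => [|i ->]; last by rewrite expr0n.
  (* The block [S0], where [g] is nonzero, makes the inequality strict; the other blocks only need
     the weak one. *)
  rewrite mulr_sumr (bigD1 S0) //= [ltRHS](bigD1 S0) //=.
  have le_term S : S \in B -> g S ^+ 2 * \sum_(i | p i == S)
      \sum_(j | Q i j) y i * y j <=
      c * (g S ^+ 2 * \sum_(i | p i == S) y i ^+ 2).
    by move=> SB; rewrite mulrCA ler_wpM2l ?sqr_ge0 // ltW // cutB.
  apply: ltr_leD; last by apply: ler_sum => S /andP[SB _]; apply: le_term.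
  by rewrite mulrCA ltr_pM2l ?cutB // exprn_even_gt0.
(* One factor 2 comes from (s - t)^2 <= 2 (s^2 + t^2), the other from symmetrizing: s^2 and t^2
   contribute equally over ordered pairs. *)
have le_energy : \sum_i \sum_(j | e i j) y i * y j * (g (p i) - g (p j)) ^+ 2 <=
    (\sum_i g (p i) ^+ 2 * \sum_(j | Q i j) y i * y j) *+ 4.
  pose D := \sum_i \sum_(j | Q i j) g (p i) ^+ 2 * (y i * y j).
  have -> : \sum_i g (p i) ^+ 2 * \sum_(j | Q i j) y i * y j = D.
    by apply: eq_bigr => i _; rewrite mulr_sumr.
  have -> : D *+ 4 = \sum_i \sum_(j | Q i j)
      (g (p i) ^+ 2 + g (p j) ^+ 2) * (y i * y j) *+ 2.
    have -> : 4%N = (2 * 2)%N by [].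
    rewrite mulrnA [D *+ 2]mulr2n {2}/D (exchange_big_dep xpredT) //=.
    rewrite -big_split -sumrMnl; apply: eq_bigr => i _ /=.
    rewrite [X in _ + X](eq_bigl (Q i)) => [|j]; last exact: Qsym.
    rewrite -big_split -sumrMnl; apply: eq_bigr => j _ /=.
    by rewrite mulrDl [y j * _]mulrC.
  apply: ler_sum => i _; rewrite big_mkcond [leRHS]big_mkcond /=.
  apply: ler_sum => j _; rewrite /Q; case: (e i j) => //=.
  have [yy_gt0|yy_le0] := ltrP 0 (y i * y j) => /=; last first.
    by rewrite mulr_le0_ge0 ?sqr_ge0.
  have [->|_] /= := eqVneq (p i) (p j); first by rewrite subrr expr0n mulr0.
  (* [(s - t)^2 <= 2 (s^2 + t^2)] *)
  rewrite mulrC -mulrnAl; apply: (ler_wpM2r (ltW yy_gt0)); rewrite -subr_ge0.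
  suff -> : (g (p i) ^+ 2 + g (p j) ^+ 2) *+ 2 - (g (p i) - g (p j)) ^+ 2 =
      (g (p i) + g (p j)) ^+ 2 by rewrite sqr_ge0.
  ring.
have energyE := energy_eigenfunction_mul (g \o p) e_sym y_eigen.
suff : (\sum_i z i * \sum_(j | e i j) (z i - z j)) *+ 2 <
    ((l + c *+ 2) * \sum_i z i ^+ 2) *+ 2 by rewrite ltrMn2r.
have -> : \sum_i z i * \sum_(j | e i j) (z i - z j) =
    \sum_i g (p i) * y i *
      \sum_(j | e i j) (g (p i) * y i - g (p j) * y j).
  by apply: eq_bigr => i _; rewrite zE; congr (_ * _);
     apply: eq_bigr => j _; rewrite !zE.
have z2E : \sum_i (g (p i) * y i) ^+ 2 = \sum_i z i ^+ 2.
  by apply: eq_bigr => i _; rewrite zE.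
rewrite energyE /= z2E mulrDl mulrnDl ltrD2l (le_lt_trans le_energy) //.
by rewrite mulrnAl -mulrnA ltrMn2r.
Qed.

(** With w = y^2 and ends of equal sign, sqrt(w_i w_j) = y_i y_j, and the minimum in [Phi] is at
    most w(S). The sign condition on [U] covers both supports at once. *)
Lemma block_cut_lt (R : realType) (V : finType) (e : rel V) (y : V -> R)
    (U : {set V}) (P : {set {set V}}) (c : R) (S : {set V}) :
  let w := fun i => y i ^+ 2 in
  (forall i j, i \in U -> (j \in U) = (0 < y i * y j)) ->
  partition P U -> S \in P -> 0 < weight w S ->
  Phi U (induced e U) w S < c ->
  \sum_(i in S) \sum_(j | [&& e i j, 0 < y i * y j & j \notin S]) y i * y j
    < c * weight w S.
Proof.
move=> w UE partP SP wS_gt0.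
have sSU : S \subset U by apply: partitionS partP SP.
rewrite /Phi; set cut := \sum_(i in S) _.
have -> : \sum_(i in S) \sum_(j | [&& e i j, 0 < y i * y j & j \notin S])
    y i * y j = cut.
  apply: eq_bigr => i iS; have iU := subsetP sSU i iS.
  apply: eq_big => [j|j /and3P[_ yy_gt0 _]].
    rewrite inE /induced /= iU -(UE i j iU).
    by case: (e i j) (j \in U) (j \in S) => [] [] [].
  by rewrite /w -exprMn sqrtr_sqr gtr0_norm.
have cut_ge0 : 0 <= cut by do 2 (apply: sumr_ge0 => ? _); exact: sqrtr_ge0.
(* If S = U the cut is empty and the quotient is 0, so that [Phi < c] reads 0 < c. *)
have [US0|/set0Pn[j jUS]] := eqVneq (U :\: S) set0.
  have -> : cut = 0.
    apply: big1 => i _; apply: big1 => j /andP[jUS _].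
    by rewrite US0 inE in jUS.
  by rewrite mul0r => c_gt0; rewrite mulr_gt0.
(* The sign condition with both indices equal to j says that y_j is nonzero for j in [U], so the
   denominator is positive. *)
have wUS_gt0 : 0 < weight w (U :\: S).
  rewrite /weight (bigD1 j) //= ltr_pwDl ?sumr_ge0 // => [|i _]; last first.
    exact: sqr_ge0.
  by rewrite /w expr2 -UE //; case/setDP: jUS.
set M := Num.min _ _; have M_gt0 : 0 < M by rewrite lt_min wS_gt0.
move=> Phi_lt.
have c_gt0 : 0 < c by apply: le_lt_trans Phi_lt; rewrite divr_ge0 // ltW.
rewrite ltr_pdivrMr // in Phi_lt; apply: lt_le_trans Phi_lt _.
by rewrite ler_pM2l // ge_min lexx.
Qed.

(** * Merging the two partitions, and the bound on the number of blocks *)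

Lemma laplacian_sym (R : realType) (V : finType) (e : rel V) :
  symmetric e -> (laplacian R e)^T = laplacian R e.
Proof.
move=> e_sym; apply/matrixP=> i j; rewrite !mxE eq_sym e_sym.
by case: eqP => // ->.
Qed.

Lemma partition_disjointU (T : finType) (P Q : {set {set T}}) (D E : {set T}) :
  partition P D -> partition Q E -> [disjoint D & E] ->
  partition (P :|: Q) (D :|: E) /\ #|P :|: Q| = (#|P| + #|Q|)%N.
Proof.
move=> partP partQ disDE; split.
  apply/and3P; split.
  - rewrite /cover bigcup_setU -!/(cover _).
    by rewrite (cover_partition partP) (cover_partition partQ).
  - apply: trivIsetU (partition_trivIset partP) (partition_trivIset partQ) _.
    by rewrite (cover_partition partP) (cover_partition partQ).
  - by rewrite inE (partition0 partP) (partition0 partQ).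
rewrite cardsU (_ : P :&: Q = set0) ?cards0 ?subn0 //.
apply/setP=> S; rewrite !inE; apply/negP=> /andP[SP SQ].
have /set0Pn[i iS] := partition_neq0 partP SP.
have iD := subsetP (partitionS partP SP) i iS.
by have := subsetP (partitionS partQ SQ) i iS; rewrite (disjointFr disDE iD).
Qed.

(** Outside the cover [pblock] returns [set0], which differs from [S] because [set0] is not a
    block. *)
Lemma pblock_eq (T : finType) (P : {set {set T}}) (S : {set T}) (x : T) :
  trivIset P -> set0 \notin P -> S \in P -> (pblock P x == S) = (x \in S).
Proof.
move=> trivP P0 SP; apply/eqP/idP => [|xS]; last exact: def_pblock.
rewrite /pblock; case: pickP => [A /andP[_ xA] <- //|_ S0].
by rewrite [set0]S0 SP in P0.
Qed.

Theorem theorem1 (R : realType) (V : finType) (e : rel V)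
  (e_sym : symmetric e) (e_irr : irreflexive e)
  (lam : #|V|.-tuple R) (lamP : ordered_spectrum (laplacian R e) lam)
  (k : nat) (k_ge1 : (1 <= k)%N) (k_le : (k <= #|V| - 1)%N)
  (y : V -> R) (y_neq0 : vec y != 0)
  (y_eigen : laplacian R e *m vec y = lam`_k.-1 *: vec y)
  (a b : nat) :
  let w := fun i => y i ^+ 2 in
  let c := (lam`_k - lam`_k.-1) / 2 in
  partitionable (supp_pos y) (induced e (supp_pos y)) w a c ->
  partitionable (supp_neg y) (induced e (supp_neg y)) w b c ->
  (a + b <= k)%N.
Proof.
move=> w c [P [partP <- Pcut]] [Q [partQ <- Qcut]].
case: lamP => lam_sorted charL.
have eigen i : \sum_(j | e i j) (y i - y j) = lam`_k.-1 * y i.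
  have /colP/(_ (enum_rank i)) := y_eigen.
  by rewrite laplacian_mul // !mxE enum_rankK.
have disPQ : [disjoint supp_pos y & supp_neg y].
  apply/pred0P => i; rewrite /= !inE; apply: contraTF isT => /andP[y_gt0].
  by rewrite ltNge (ltW y_gt0).
have [partB <-] := partition_disjointU partP partQ disPQ.
set B := P :|: Q in partB *; pose p := pblock B.
have [/eqP covB trivB B0] := and3P partB.
apply: leq_trans (count_lt_nth_le k lam_sorted).
(* The rows are the restrictions of y to the blocks. *)
pose W : 'M[R]_(#|B|, #|V|) :=
  \matrix_(r, i) ((p (enum_val i) == enum_val r)%:R * y (enum_val i)).
apply: (symmetric_inertia (W := W) (laplacian_sym R e_sym) charL) => v v0.
(* The coefficient of [v] at the block S, written as a sum so that it is defined on every set and is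
   0 outside [B]. *)
pose g S := \sum_(r | enum_val r == S) v 0 r.
pose z i := g (p i) * y i.
have -> : v *m W = (vec z)^T.
  apply/rowP=> i; rewrite !mxE /z /g mulr_suml [RHS]big_mkcond /=.
  by apply: eq_bigr => r _; rewrite mxE eq_sym; case: eqP => _;
    rewrite ?mul1r // mul0r mulr0.
rewrite trmxK mulmxBr mulmxBl mul_mx_scalar -scalemxAl -mulmxA laplacian_mul //.
rewrite mxE [X in _ + X]mxE [X in X + _]mxE !vec_dotE subr_gt0.
have -> : \sum_i z i * z i = \sum_i z i ^+ 2 by [].
have -> : lam`_k = lam`_k.-1 + c *+ 2.
  by rewrite /c -mulr_natr mulfVK ?pnatr_eq0 // addrC subrK.
(* The sign s is 1 for the positive support and -1 for the negative one. *)
have supp_same (s : R) (U : {set V}) : (forall i, (i \in U) = (0 < s * y i)) ->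
    forall i j, i \in U -> (j \in U) = (0 < y i * y j).
  move=> UE i j; rewrite !UE => sy_gt0.
  have s2_gt0 : 0 < s ^+ 2.
    by rewrite exprn_even_gt0 //=; apply: contraTneq sy_gt0 => ->;
      rewrite mul0r ltxx.
  have syE : s ^+ 2 * (y i * y j) = (s * y i) * (s * y j) by ring.
  by rewrite -[RHS](pmulr_rgt0 _ s2_gt0) syE (pmulr_rgt0 _ sy_gt0).
apply: (energy_lt e_sym eigen (B := B) (p := p) (g := g)) => // [i y0|S SB|].
- by rewrite pblock_mem // covB !inE orbC -neq_lt.
- have pS i : (p i == S) = (i \in S) by exact: pblock_eq.
  rewrite !(eq_bigl _ _ pS).
  rewrite (eq_bigr (fun i => \sum_(j | [&& e i j, 0 < y i * y j & j \notin S])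
    y i * y j)) => [|i iS]; last first.
    by apply: eq_bigl => j; rewrite -pS eq_sym -(eqP (etrans (pS i) iS)).
  have [SP|SQ] := setUP SB.
  + have [wS_gt0 PhiS] := Pcut S SP.
    apply: block_cut_lt partP SP wS_gt0 PhiS.
    by apply: (supp_same 1) => i; rewrite inE mul1r.
  + have [wS_gt0 PhiS] := Qcut S SQ.
    apply: block_cut_lt partQ SQ wS_gt0 PhiS.
    by apply: (supp_same (-1)) => i; rewrite inE mulN1r oppr_gt0.
- have /rV0Pn[r vr0] := v0.
  exists (enum_val r); first exact: enum_valP.
  by rewrite /g (big_pred1 r) // => r'; rewrite /= (inj_eq enum_val_inj).
Qed.
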